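(* Let $2\le k\le n$. In the asynchronous Data Retrieval model with $k$ peers, an $n$-bit source and at most $1$ crash fault, there is a deterministic protocol that solves Download with $$\mathcal Q=\frac nk+\left\lceil\frac{n}{k(k-1)}\right\rceil,\qquad \mathcal T=\tilde O\!\left(\frac nk\right),\qquad \mathcal M=O(nk).$$
   Context: Data Retrieval (DR) model. There are $k$ peers with unique IDs forming a complete network, and a trusted read-only external source storing an array $X=(b_1,\dots,b_n)\in\{0,1\}^n$, with $n\ge k$. A query $\mathrm{Query}(i)$ by a peer to the source returns $b_i$. A peer may send a different message to each other peer; messages have size $O(\log n)$ bits, and larger messages are broken into packets of that size. Local computation is free. Asynchrony: an adversary may delay every message by any finite amount of time. Time is measured in the usual normalized way: every message takes at most one time unit to be delivered, and one $O(\log n)$-bit packet can be sent per link per time unit. Crash faults: a crashed peer stops its execution permanently at an arbitrary point chosen by an all-knowing adversary (possibly after sending only some of its messages). At most one peer crashes; the others are nonfaulty. The adversary also chooses $X$. Download problem: every nonfaulty peer must output an array equal to $X$. Complexity measures (all worst-case upper bounds): $\mathcal Q$ = maximum number of bits queried by any nonfaulty peer; $\mathcal T$ = time until termination; $\mathcal M$ = total number of messages sent by nonfaulty peers. $\tilde O(\cdot)$ hides polylogarithmic factors in $n$ and $k$.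
   Formalization: The term n/k in the query bound is rounded up to ⌈n/k⌉ when k does not divide n; the unrounded bound fails, e.g. for n=5, k=3, where it would allow only 2 queries per peer and two surviving peers could see only 4 of 5 bits. *)

(* Defs.v *)
From mathcomp Require Import all_boot all_order all_algebra reals.
Set Implicit Arguments.
Unset Strict Implicit.
Unset Printing Implicit Defensive.
Import Order.TTheory GRing.Theory Num.Theory.

Section Protocol.
Variables n k B : nat.

Definition packet := {bseq B of bool}.

(* [Receive] blocks until the inbox is nonempty; [Output] halts the peer. *)
Inductive action (S : Type) : Type :=
| Query of 'I_n & (bool -> S)
| Send of 'I_k & packet & S
| Receive of ('I_k -> packet -> S)
| Output of n.-tuple bool.

(* A deterministic protocol for peers 'I_k.  The initial state depends on the
   ID of the peer only; the source is accessible through [Query] alone. *)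
Record protocol : Type := Protocol {
  state : Type;
  init : 'I_k -> state;
  act : state -> action state
}.

End Protocol.

Arguments Query {n k B S}.
Arguments Send {n k B S}.
Arguments Receive {n k B S}.
Arguments Output {n k B S}.

Definition upd (I : eqType) (T : Type) (f : I -> T) (i : I) (v : T) : I -> T :=
  fun j => if j == i then v else f j.

Section Model.
Variables (n k B : nat) (P : protocol n k B).

(* A directed link: (sender, receiver). *)
Definition link := ('I_k * 'I_k)%type.

(* The packets of a link are numbered 0, 1, ... in the order in which its
   sender issued them.  A packet goes through three stages: it is issued (and
   enters the outgoing FIFO queue of the link), it is transmitted (it leaves
   the queue; this needs a sender that has not crashed, so a crash discards
   what is still in the queues of the crashed peer), and it is delivered to
   the inbox of the receiver.  Transmitted packets may overtake each other. *)
Record config : Type := Config {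
  loc : 'I_k -> state P;
  crashed : {set 'I_k};
  queried : 'I_k -> nat;               (* number of queries made so far *)
  issued : link -> seq (packet B);     (* all packets issued so far *)
  transmitted : link -> nat;           (* number of packets transmitted *)
  delivered : link -> seq nat;         (* numbers of the delivered packets *)
  inbox : 'I_k -> seq ('I_k * packet B)
}.

Definition init_config : config :=
  Config (@init _ _ _ P) set0 (fun=> 0) (fun=> [::]) (fun=> 0) (fun=> [::])
    (fun=> [::]).

Definition output (c : config) (i : 'I_k) : option (n.-tuple bool) :=
  if act (loc c i) is Output a then Some a else None.

(* Peer [i] can take a local step.  A peer cannot send to itself: a protocol
   attempting to do so blocks. *)
Definition active (c : config) (i : 'I_k) : bool :=
  (i \notin crashed c) &&
  match act (loc c i) with
  | Query _ _ => true
  | Send j _ _ => j != i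
  | Receive _ => inbox c i != [::]
  | Output _ => false
  end.

Definition local_step (X : n.-tuple bool) (c : config) (i : 'I_k) : config :=
  let: Config s F q iss tr dl ib := c in
  match act (s i) with
  | Query b next =>
      Config (upd s i (next (tnth X b))) F (upd q i (q i).+1) iss tr dl ib
  | Send j m next =>
      Config (upd s i next) F q (upd iss (i, j) (rcons (iss (i, j)) m)) tr dl ib
  | Receive next =>
      if ib i is (j, m) :: ib' then
        Config (upd s i (next j m)) F q iss tr dl (upd ib i ib')
      else c
  | Output _ => c
  end.

Inductive event : Type :=
| Local of 'I_k
| Transmit of link
| Deliver of link & nat
| Crash of 'I_k.

(* Events that are not enabled leave the configuration unchanged. *)
Definition step (X : n.-tuple bool) (c : config) (e : event) : config :=
  match e with
  | Local i => if active c i then local_step X c i else c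
  | Transmit l =>
      if (l.1 \notin crashed c) && (transmitted c l < size (issued c l)) then
        let: Config s F q iss tr dl ib := c in
        Config s F q iss (upd tr l (tr l).+1) dl ib
      else c
  | Deliver l r =>
      if (r < transmitted c l) && (r \notin delivered c l) then
        let: Config s F q iss tr dl ib := c in
        Config s F q iss tr (upd dl l (r :: dl l))
          (upd ib l.2 (rcons (ib l.2) (l.1, nth [bseq] (iss l) r)))
      else c
  | Crash i =>
      let: Config s F q iss tr dl ib := c in
      Config s (i |: F) q iss tr dl ib
  end.

(* The adversary chooses the source array [X] and the sequence of events
   [ev]; [conf X ev t] is the configuration before event number [t]. *)
Fixpoint conf (X : n.-tuple bool) (ev : nat -> event) (t : nat) : config :=
  if t is t'.+1 then step X (conf X ev t') (ev t') else init_config.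

Definition nonfaulty X ev (i : 'I_k) : Prop :=
  forall t, i \notin crashed (conf X ev t).

(* All delays are finite, and at most [f] peers crash.  Delivery is required at
   every receiver: it only fills the inbox, so for a receiver that has crashed
   or halted it has no effect. *)
Record admissible (f : nat) (X : n.-tuple bool) (ev : nat -> event) : Prop :=
  Admissible {
  few_crashes : forall t, #|crashed (conf X ev t)| <= f;
  fair_local : forall t i, active (conf X ev t) i ->
    exists2 t', t <= t' & ev t' = Local i \/ i \in crashed (conf X ev t');
  fair_transmit : forall t l r, r < size (issued (conf X ev t) l) ->
    exists t', r < transmitted (conf X ev t') l \/
               l.1 \in crashed (conf X ev t');
  fair_deliver : forall t l r, r < transmitted (conf X ev t) l ->
    exists t', r \in delivered (conf X ev t') l
}.

(* Event number [t] is the issue, resp. transmission, of packet [r] of [l]. *)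
Definition issues X ev (t : nat) (l : link) (r : nat) : Prop :=
  size (issued (conf X ev t) l) <= r < size (issued (conf X ev t.+1) l).

Definition transmits X ev (t : nat) (l : link) (r : nat) : Prop :=
  transmitted (conf X ev t) l <= r < transmitted (conf X ev t.+1) l.

(* [tau t] is the normalized time of event number [t].  Local computation and
   queries take no time: time stands still while some peer is active.  A link
   transmits a packet as soon as it is issued and one time unit has elapsed
   since the previous transmission, and a packet arrives within one time unit
   of its transmission.  These are upper bounds only: the adversary is free to
   make any link faster, as otherwise the lower bounds on the delays would make
   the network partially synchronous. *)
Record normalized_time (R : realType) (X : n.-tuple bool) (ev : nat -> event)
    (tau : nat -> R) : Prop := NormalizedTime {
  time_start : tau 0 = 0%R;
  time_mono : forall t, (tau t <= tau t.+1)%R;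
  time_local : forall t i, active (conf X ev t.+1) i -> tau t.+1 = tau t;
  time_transmit_first : forall l s u,
    issues X ev s l 0 -> (tau s < tau u)%R ->
    0 < transmitted (conf X ev u) l \/ l.1 \in crashed (conf X ev u);
  time_transmit_next : forall l r s t u,
    issues X ev s l r.+1 -> transmits X ev t l r ->
    (Num.max (tau s) (tau t + 1) < tau u)%R ->
    r.+1 < transmitted (conf X ev u) l \/ l.1 \in crashed (conf X ev u);
  time_deliver : forall l r t u,
    transmits X ev t l r -> (tau t + 1 < tau u)%R ->
    r \in delivered (conf X ev u) l
}.

Definition solves_download (f : nat) : Prop :=
  forall X ev, admissible f X ev ->
  forall i, nonfaulty X ev i -> exists t, output (conf X ev t) i = Some X.

Definition query_complexity_le (f q : nat) : Prop :=
  forall X ev, admissible f X ev ->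
  forall i, nonfaulty X ev i -> forall t, queried (conf X ev t) i <= q.

Definition time_complexity_le (R : realType) (f : nat) (T : R) : Prop :=
  forall X ev (tau : nat -> R), admissible f X ev -> normalized_time X ev tau ->
  forall i, nonfaulty X ev i ->
  exists2 t, (tau t <= T)%R & output (conf X ev t.+1) i.

(* Nonfaultiness depends on the whole infinite execution, hence is not decidable:
   the sum ranges over an arbitrary set of nonfaulty peers. *)
Definition message_complexity_le (f m : nat) : Prop :=
  forall X ev, admissible f X ev ->
  forall H : {set 'I_k}, (forall i, i \in H -> nonfaulty X ev i) ->
  forall t, \sum_(i in H) \sum_j size (issued (conf X ev t) (i, j)) <= m.

End Model.

(* The ceiling of a / b, for b > 0. *)
Definition ceil_div (a b : nat) : nat := (a + b.-1) %/ b.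

(* Main.v *)
Require Import Defs.
From mathcomp Require Import all_boot all_order all_algebra reals.
From mathcomp Require Import zify lra.
From Stdlib Require Import Classical.
Set Implicit Arguments.
Unset Strict Implicit.
Unset Printing Implicit Defensive.
Import Order.TTheory GRing.Theory Num.Theory.

(* Give every bit b a primary owner b mod k, and a secondary owner, distinct from
   the primary one, such that each peer owns at most ceil(n/k) bits in either
   role and any primary block shares at most ceil(n/(k(k-1))) bits with any
   secondary block.  Peer i queries its primary block.  As soon as it knows all
   primary blocks except at most one, it queries those bits of its secondary
   block that it is still missing; these lie in a single primary block.  It sends
   every bit it owns, in either role, to everyone as soon as it knows it, so that
   a link carries at most 2 ceil(n/k) packets, and it stops when it knows X.

   With one crash, at most one primary block stays incomplete at a nonfaulty
   peer, so every nonfaulty peer ends up knowing its secondary block.  A bit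
   therefore reaches everybody from one of its two owners, the other one being
   the peer that crashed at worst.  No peer has to find out whether the silent
   peer has crashed or is slow, and peers may miss different blocks. *)

Lemma sum_upd (I : finType) (T : Type) (w : T -> nat) (f g : I -> T) i v :
  (forall j, g j = if j == i then v else f j) ->
  \sum_j w (g j) + w (f i) = \sum_j w (f j) + w v.
Proof.
move=> gE; rewrite (bigD1 i) //= [in RHS](bigD1 i) //= gE eqxx.
under eq_bigr => j ji do rewrite gE (negbTE ji).
lia.
Qed.

(** Induction on the bound: once the bound is attained the sequence is constant, and if it never is,
    the bound drops by one. *)
Lemma bounded_mono_stable (f : nat -> nat) M :
  (forall t, f t <= f t.+1) -> (forall t, f t <= M) ->
  exists N, forall t, N <= t -> f t = f N.
Proof.
move=> fS fM; have fmono := homo_leq leqnn leq_trans fS.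
elim: M => [|M IH] in f fS fM fmono *.
  by exists 0 => t _; have := fM t; have := fM 0; lia.
have [[N fN]|noN] := classic (exists N, f N = M.+1).
  by exists N => t /fmono; have := fM t; lia.
apply: IH => // t; rewrite -ltnS ltn_neqAle fM andbT.
by apply/eqP => ft; apply: noN; exists t.
Qed.

(** * Executions of an arbitrary protocol *)

Section Executions.
Variables (n k B : nat) (P : protocol n k B) (X : n.-tuple bool).
Implicit Types (c : config P) (e : event k) (i j : 'I_k) (l : link k).

Definition extends c c' : Prop :=
  [/\ crashed c \subset crashed c',
      forall l, prefix (issued c l) (issued c' l),
      forall l, transmitted c l <= transmitted c' l &
      forall l, {subset delivered c l <= delivered c' l}].

Lemma extends_refl c : extends c c.
Proof. by split=> [|l|l|l r]; rewrite ?prefix_refl. Qed.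

Lemma extends_trans c2 c1 c3 : extends c1 c2 -> extends c2 c3 -> extends c1 c3.
Proof.
move=> [F1 i1 t1 d1] [F2 i2 t2 d2]; split=> [|l|l|l r].
- exact: subset_trans F1 F2.
- exact: prefix_trans (i1 l) (i2 l).
- exact: leq_trans (t1 l) (t2 l).
- by move=> /d1 /d2.
Qed.

Lemma extends_step c e : extends c (step X c e).
Proof.
case: c => s F q iss tr dl ib; case: e => [i|l|l r|i] /=.
- case: ifP => _; last exact: extends_refl.
  rewrite /local_step; case: (act (s i)) => [b nx|j m nx|nx|a].
  + by split=> [|l|l|l r] //=; exact: prefix_refl.
  + split=> [|l|l|l r] //=; rewrite /upd; case: eqP => [->|_].
      exact: prefix_rcons.
    exact: prefix_refl.
  + by case: (ib i) => [|[j p] ib']; split=> [|l|l|l r] //=; exact: prefix_refl.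
  + exact: extends_refl.
- case: ifP => _; last exact: extends_refl.
  split=> [|l'|l'|l' r'] //=; first exact: prefix_refl.
  by rewrite /upd; case: eqP => [->|].
- case: ifP => _; last exact: extends_refl.
  split=> [|l'|l'|l' r'] //=; first exact: prefix_refl.
  by rewrite /upd; case: eqP => [->|] // r'dl; rewrite inE r'dl orbT.
- split=> [|l'|l'|l' r'] //=; first exact: subsetUr.
  exact: prefix_refl.
Qed.

(** The field [wf_inbox] keeps the subtraction in [progress] from being truncated. *)
Record links_wf c : Prop := LinksWf {
  wf_transmitted : forall l, transmitted c l <= size (issued c l);
  wf_delivered : forall l r, r \in delivered c l -> r < transmitted c l;
  wf_uniq : forall l, uniq (delivered c l);
  wf_inbox : \sum_i size (inbox c i) <= \sum_l size (delivered c l)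
}.

Lemma links_wf_step c e : links_wf c -> links_wf (step X c e).
Proof.
case: c => s F q iss tr dl ib; case: e => [i|l|l r|i] /= wf; last by case: wf.
- case: ifP => // _; rewrite /local_step.
  case: (act (s i)) => [b nx|j m nx|nx|a] //; first by case: wf.
    case: wf => /= t d u b; split=> //= l.
    by rewrite /upd; case: eqP => [->|//]; rewrite size_rcons ltnW ?ltnS.
  case Ei: (ib i) => [|[j p] ib'] //; case: wf => /= t d u b; split=> //=.
  by have /= := sum_upd size (g := upd ib i ib') (fun=> erefl);
    rewrite Ei /=; lia.
- case: ifP => // /andP[_ lt]; case: wf => /= t d u b; split=> //= l'.
    by rewrite /upd; case: eqP => [->|].
  by move=> r /d; rewrite /upd; case: eqP => [->|//]; exact: ltnW.
- case: ifP => // /andP[lt nin]; case: wf => /= t d u b; split=> //=.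
  + move=> l' r'; rewrite /upd; case: eqP => [->|_]; last exact: d.
    by rewrite inE => /predU1P[->|/d].
  + by move=> l'; rewrite /upd; case: eqP => //= _; rewrite nin u.
  + have /= := sum_upd size (g := upd dl l (r :: dl l)) (fun=> erefl).
    have /= := sum_upd size (fun=> erefl)
      (g := upd ib l.2 (rcons (ib l.2) (l.1, nth [bseq] (iss l) r))).
    by rewrite size_rcons /=; lia.
Qed.

(* A delivery also lengthens an inbox, so it counts twice. *)
Definition progress c : nat :=
  \sum_i queried c i + \sum_l size (issued c l) + \sum_l transmitted c l +
  (\sum_l size (delivered c l)).*2 - \sum_i size (inbox c i) + #|crashed c|.

(** A query or a send raises a counter, and a [Receive] shortens an inbox, which enters [progress]
    negatively. *)
Lemma progress_local c i : links_wf c -> active c i ->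
  progress c < progress (step X c (Local i)).
Proof.
move=> wf ai /=; rewrite ai; case: c => s F q iss tr dl ib in wf ai *.
have {wf} /= b := wf_inbox wf; move: ai; rewrite /active /local_step /progress /=.
case: (act (s i)) => [x nx|j m nx|nx|a] /=; last by rewrite andbF.
- by move=> _; have /= := sum_upd id (g := upd q i (q i).+1) (fun=> erefl); lia.
- move=> _; have /= := sum_upd size (fun=> erefl)
    (g := upd iss (i, j) (rcons (iss (i, j)) m)).
  by rewrite size_rcons /=; lia.
- case Ei: (ib i) => [|[j p] ib'] /=; first by rewrite andbF.
  by move=> _; have /= := sum_upd size (g := upd ib i ib') (fun=> erefl);
    rewrite Ei /=; lia.
Qed.

Lemma progress_step c e : links_wf c ->
  step X c e = c \/ progress c < progress (step X c e).
Proof.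
move=> wf; case: e => [i|l|l r|i].
- have [ai|/negbTE ni] := boolP (active c i); last by left; rewrite /= ni.
  by right; exact: progress_local.
- rewrite /=; case: ifP => _; [right|by left].
  case: c wf => s F q iss tr dl ib [_ _ _ /= b]; rewrite /progress /=.
  by have /= := sum_upd id (g := upd tr l (tr l).+1) (fun=> erefl); lia.
- rewrite /=; case: ifP => _; [right|by left].
  case: c wf => s F q iss tr dl ib [_ _ _ /= b]; rewrite /progress /=.
  have /= := sum_upd size (g := upd dl l (r :: dl l)) (fun=> erefl).
  have /= := sum_upd size (fun=> erefl)
    (g := upd ib l.2 (rcons (ib l.2) (l.1, nth [bseq] (iss l) r))).
  by rewrite size_rcons /=; lia.
- rewrite /=; case: c wf => s F q iss tr dl ib [_ _ _ /= b]; rewrite /progress /=.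
  have [iF|iF] := boolP (i \in F); last by right; rewrite ltn_add2l cardsU1 iF.
  by left; congr Config; apply/setUidPr; rewrite sub1set.
Qed.

(** Delivered numbers are distinct and below the number of transmitted packets, so a bound on the
    issued packets covers all three stages. *)
Lemma progress_le c Q M : links_wf c -> (forall i, queried c i <= Q) ->
  (forall l, size (issued c l) <= M) ->
  progress c <= \sum_(i < k) Q + \sum_(l : link k) M + \sum_(l : link k) M +
                (\sum_(l : link k) M).*2 + k.
Proof.
case=> t d u _ qQ iM.
have tM l : transmitted c l <= M := leq_trans (t l) (iM l).
have dM l : size (delivered c l) <= M.
  apply: leq_trans (tM l); rewrite -(size_iota 0 (transmitted c l)).
  by apply: uniq_leq_size (u l) _ => r /d; rewrite mem_iota.
have FK : #|crashed c| <= k by rewrite -[leqRHS]card_ord max_card.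
rewrite /progress leq_add //; apply: leq_trans (leq_subr _ _) _.
by rewrite !leq_add ?leq_double ?leq_sum.
Qed.

Variable ev : nat -> event k.
Local Notation conf := (@conf n k B P X ev).

Lemma extends_conf t t' : t <= t' -> extends (conf t) (conf t').
Proof.
by move: t t'; apply: homo_leq => [c|c2 c1 c3|t];
  [exact: extends_refl|exact: extends_trans|exact: extends_step].
Qed.

Lemma crashed_conf t t' i : t <= t' -> i \in crashed (conf t) ->
  i \in crashed (conf t').
Proof. by move/extends_conf => [/subsetP sF _ _ _]; exact: sF. Qed.

Lemma nth_issued_conf t t' l r : t <= t' -> r < size (issued (conf t) l) ->
  nth [bseq] (issued (conf t') l) r = nth [bseq] (issued (conf t) l) r.
Proof.
move/extends_conf => [_ /(_ l)/prefixP[s ->] _ _] rlt.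
by rewrite nth_cat rlt.
Qed.

Lemma conf_wf t : links_wf (conf t).
Proof.
elim: t => [|t IH]; last exact: links_wf_step.
by split=> //=; rewrite !big1.
Qed.

Lemma issued_at t l r : r < size (issued (conf t) l) ->
  exists2 s, s < t & issues P X ev s l r.
Proof.
elim: t => [//|t IH] rlt.
have [/IH[s st iss]|rge] := ltnP r (size (issued (conf t) l)).
  by exists s => //; exact: ltnW.
by exists t => //; apply/andP.
Qed.

Lemma transmitted_at t l r : r < transmitted (conf t) l ->
  exists2 s, s < t & transmits P X ev s l r.
Proof.
elim: t => [//|t IH] rlt.
have [/IH[s st iss]|rge] := ltnP r (transmitted (conf t) l).
  by exists s => //; exact: ltnW.
by exists t => //; apply/andP.
Qed.

Definition quiescent c : Prop := forall i, ~~ active c i.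

(** The sender must still be alive at [u], since a crash after [t] can discard packets that were
    queued at [t]. *)
Definition arrived t u : Prop := forall l r, r < size (issued (conf t) l) ->
  l.1 \notin crashed (conf u) -> r \in delivered (conf u) l.

(** Bounded [progress] becomes constant, and then so does the configuration, as any effective event
    raises [progress]. Fairness excludes an active peer or a pending packet of a live sender in this
    final configuration. *)
Lemma eventually_settled f M : admissible P f X ev ->
  (forall t, progress (conf t) <= M) ->
  exists N, [/\ quiescent (conf N), arrived N N &
                forall t, N <= t -> conf t = conf N].
Proof.
move=> adm bnd.
have prS t : progress (conf t) <= progress (conf t.+1).
  by have /= [->|/ltnW] := progress_step (ev t) (conf_wf t).
have [N stable] := bounded_mono_stable prS bnd.
have const t : N <= t -> conf t = conf N.
  elim: t => [|t IH]; first by rewrite leqn0 => /eqP->.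
  rewrite leq_eqVlt => /predU1P[-> //|]; rewrite ltnS => Nt.
  have [E|] := progress_step (ev t) (conf_wf t).
    by rewrite [conf t.+1]/= E IH.
  by rewrite -/(conf t.+1) (stable t) // (stable t.+1) ?ltnn // ltnW.
exists N; split=> // [i|l r rlt nF].
  apply/negP => ai; have [t' Nt' []] := fair_local adm ai.
    move=> evt'; have ai' : active (conf t') i by rewrite const.
    have := progress_local (conf_wf t') ai'; rewrite -evt' -/(conf t'.+1).
    by rewrite (const t') // (const t'.+1) ?ltnn // leqW.
  by rewrite const // => iF; move: ai; rewrite /active iF.
have [t [rt|lF]] := fair_transmit adm rlt; last first.
  have := crashed_conf (leq_maxl t N) lF.
  by rewrite const ?leq_maxr // (negbTE nF).
have [t' rd] := fair_deliver adm rt.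
have [_ _ _ /(_ _ _ rd)] := extends_conf (leq_maxl t' N).
by rewrite const ?leq_maxr.
Qed.

(** * Consequences of normalized time *)

Section Time.
Variables (R : realType) (tau : nat -> R).
Hypothesis nt : normalized_time P X ev tau.
Local Open Scope ring_scope.

Lemma tau_homo t t' : (t <= t')%N -> tau t <= tau t'.
Proof.
move: t t'; apply: (@homo_leq _ tau (fun x y => x <= y)).
- exact: lexx.
- exact: le_trans.
- exact: time_mono nt.
Qed.

(** The [r] packets ahead in the FIFO queue cost at most one time unit each. *)
Lemma transmitted_by a s l r u : issues P X ev s l r -> tau s <= a ->
  a + r%:R < tau u ->
  (r < transmitted (conf u) l)%N \/ l.1 \in crashed (conf u).
Proof.
elim: r s u => [|r IH] s u iss sa au.
  by apply: (time_transmit_first nt iss); lra.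
have [s' s's iss'] : exists2 s', (s' <= s)%N & issues P X ev s' l r.
  case/andP: iss => _ lt.
  by have [s' ? ?] := issued_at (ltnW lt); exists s'.
have s'a : tau s' <= a := le_trans (tau_homo s's) sa.
have au' : a + r%:R + 1 < tau u by rewrite -addrA natr1.
have ru : a + r%:R < tau u by lra.
have [rt|] := IH s' u iss' s'a ru; last by right.
have [t tu tr] := transmitted_at rt.
(* Had packet [r] left after time [a + r], the induction hypothesis at [t] would say that it had
   left already or that its sender had crashed. *)
have [ta|/(IH _ _ iss' s'a)[]] := leP (tau t) (a + r%:R).
- apply: (time_transmit_next nt iss tr).
  have r0 : 0 <= r%:R :> R by [].
  by rewrite gt_max; apply/andP; split; lra.
- by case/andP: tr => le _; rewrite ltnNge le.
- by move/(crashed_conf (ltnW tu)); right.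
Qed.

(** Packet numbers are below [M], so a live sender has transmitted them by time [a + M - 1]; the
    last unit is for delivery. *)
Lemma arrived_after a M t u :
  (forall l, size (issued (conf t) l) <= M)%N ->
  (forall s, (s < t)%N -> tau s <= a) -> a + M%:R < tau u -> arrived t u.
Proof.
move=> szM ta au l r rlt nF.
have [s st iss] := issued_at rlt.
have rM : r%:R + 1 <= M%:R :> R.
  by rewrite natr1 ler_nat (leq_trans rlt).
have ru : a + r%:R < tau u by lra.
have [rt|] := transmitted_by iss (ta _ st) ru; last by rewrite (negbTE nF).
have [v vu tr] := transmitted_at rt.
have [va|vlt] := leP (tau v) (a + r%:R).
  by apply: (time_deliver nt tr); lra.
have [lt|] := transmitted_by iss (ta _ st) vlt.
  by case/andP: tr => le _; move: lt; rewrite ltnNge le.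
by move/(crashed_conf (ltnW vu)); rewrite (negbTE nF).
Qed.

(* Local computation takes no time, so nobody is active when the clock moves. *)
Lemma first_after a u : 0 <= a -> a < tau u ->
  exists v, [/\ quiescent (conf v), (v <= u)%N, a < tau v &
                forall s, (s < v)%N -> tau s <= a].
Proof.
move=> a0 au; have ex : exists v, a < tau v by exists u.
case: (ex_minnP ex) => v av vmin; exists v; split=> //; last first.
- by move=> s; apply: contraTT; rewrite -ltNge -leqNgt => /vmin.
- exact: vmin.
case: v av vmin => [|v] av vmin; first by move: av; rewrite (time_start nt); lra.
move=> i; apply/negP => /(time_local nt) tv.
by have := vmin v; rewrite -tv av ltnn => /(_ isT).
Qed.

End Time.
End Executions.

(** * The protocol, for abstract owners of the bits *)

Section Download.
Variables (n k B : nat) (own1 own2 : 'I_n -> 'I_k).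
Variable (enc : 'I_n * bool -> packet B).
Variable (dec : packet B -> option ('I_n * bool)).
Hypothesis encK : pcancel enc dec.
Hypothesis own_neq : forall b, own1 b != own2 b.

Record peer : Type := Peer {
  me : 'I_k;
  view : {ffun 'I_n -> option bool};
  sent : 'I_k -> seq 'I_n
}.
Implicit Types (s : peer) (b : 'I_n) (i j : 'I_k) (v : bool) (x : 'I_n * 'I_k).

Definition known s b : bool := view s b.
Definition value s b : bool := odflt false (view s b).
Definition mine i b : bool := (own1 b == i) || (own2 b == i).
Definition all_but s j : bool := [forall b, (own1 b != j) ==> known s b].

Definition to_query s b : bool :=
  ~~ known s b &&
  ((own1 b == me s) || (own2 b == me s) && [exists j, all_but s j]).

Definition to_send s x : bool :=
  [&& known s x.1, mine (me s) x.1, x.2 != me s & x.1 \notin sent s x.2].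

Definition learn s b v : peer :=
  Peer (me s) [ffun b' => if b' == b then Some v else view s b'] (sent s).

Definition mark s x : peer :=
  Peer (me s) (view s) (upd (sent s) x.2 (rcons (sent s x.2) x.1)).

(** The order matters: a peer halts or waits only when it has nothing left to query or to send, so
    inactivity means that its duties are done. *)
Definition peer_act s : action n k B peer :=
  if [pick b | to_query s b] is Some b then Query b (learn s b)
  else if [pick x | to_send s x] is Some x then
    Send x.2 (enc (x.1, value s x.1)) (mark s x)
  else if [forall b, known s b] then Output [tuple value s b | b < n]
  else Receive (fun _ p => if dec p is Some (b, v) then learn s b v else s).

Definition download : protocol n k B :=
  @Protocol n k B peer (fun i => Peer i [ffun=> None] (fun=> [::])) peer_act.

Lemma known_learn s b v b' : known (learn s b v) b' = (b' == b) || known s b'.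
Proof. by rewrite /known ffunE; case: eqP. Qed.

Lemma all_but_learn s b v j : all_but s j -> all_but (learn s b v) j.
Proof.
move=> /forallP aj; apply/forallP => b'; apply/implyP => /(implyP (aj b')).
by rewrite known_learn orbC => ->.
Qed.

(** Known bits stand in for queried ones; bits learned from messages only enlarge the set, which is
    harmless for an upper bound. *)
Definition asked1 s : {set 'I_n} := [set b | known s b && (own1 b == me s)].
Definition asked2 s j : {set 'I_n} :=
  [set b | [&& known s b, own1 b == j & own2 b == me s]].

(* [j] is the owner of the only incomplete block when the first query to a
   secondary block is made; before that its term vanishes. *)
Definition query_budget s q : Prop :=
  exists j, q <= #|asked1 s| + all_but s j * #|asked2 s j|.

Lemma asked1_learn s b v : asked1 s \subset asked1 (learn s b v).
Proof.
apply/subsetP => b'; rewrite !inE known_learn /= => /andP[-> ->].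
by rewrite orbT.
Qed.

Lemma asked2_learn s b v j : asked2 s j \subset asked2 (learn s b v) j.
Proof.
apply/subsetP => b'; rewrite !inE known_learn /= => /and3P[-> -> ->].
by rewrite orbT.
Qed.

Lemma query_budget_learn s b v q :
  query_budget s q -> query_budget (learn s b v) q.
Proof.
case=> j le; exists j; apply: leq_trans le _; apply: leq_add.
  exact/subset_leq_card/asked1_learn.
case aj: (all_but s j) => //; rewrite all_but_learn // !mul1n.
exact/subset_leq_card/asked2_learn.
Qed.

Lemma query_budget_query s b v q : to_query s b ->
  query_budget s q -> query_budget (learn s b v) q.+1.
Proof.
case/andP => nb /orP[ob|/andP[ob /existsP[j0 aj0]]] [j le].
- have : #|asked1 s| < #|asked1 (learn s b v)|.
    apply: proper_card; apply/properP; split; first exact: asked1_learn.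
    by exists b; rewrite !inE ?known_learn ?eqxx ?(negbTE nb).
  exists j; have : all_but s j * #|asked2 s j| <=
      all_but (learn s b v) j * #|asked2 (learn s b v) j|.
    case aj: (all_but s j) => //; rewrite all_but_learn // !mul1n.
    exact/subset_leq_card/asked2_learn.
  lia.
(* The unknown bit [b] pins down the incomplete block. *)
- have own_b j' : all_but s j' -> own1 b = j'.
    move/forallP/(_ b); rewrite (negbTE nb) implybF negbK; exact/eqP.
  have le1 : #|asked1 s| <= #|asked1 (learn s b v)|.
    exact/subset_leq_card/asked1_learn.
  have lt2 j' : all_but s j' -> #|asked2 s j'| < #|asked2 (learn s b v) j'|.
    move/own_b => oj; apply: proper_card; apply/properP.
    split; first exact: asked2_learn.
    by exists b; rewrite !inE ?known_learn ?eqxx ?(negbTE nb) ?ob ?oj ?eqxx.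
  (* If the second term was still zero, the witness may change freely, here to [j0]. *)
  case aj: (all_but s j) in le.
    exists j; rewrite all_but_learn // mul1n; have := lt2 j aj; lia.
  by exists j0; rewrite all_but_learn // mul1n; have := lt2 j0 aj0; lia.
Qed.

(** * Invariants and correctness of the protocol *)

Section Correctness.
Variable X : n.-tuple bool.

Definition msg b : packet B := enc (b, tnth X b).

Record peer_inv i s (q : nat) : Prop := PeerInv {
  inv_me : me s = i;
  inv_view : forall b v, view s b = Some v -> v = tnth X b;
  inv_mine : forall j b, b \in sent s j -> mine i b;
  inv_uniq : forall j, uniq (sent s j);
  inv_budget : query_budget s q
}.

Lemma peer_inv_learn i s b q :
  peer_inv i s q -> peer_inv i (learn s b (tnth X b)) q.
Proof.
case=> m w mi u bu; split=> //; last exact: query_budget_learn.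
by move=> b' v; rewrite ffunE; case: eqP => [-> [<-]|_ /w].
Qed.

Lemma peer_inv_query i s b q : to_query s b ->
  peer_inv i s q -> peer_inv i (learn s b (tnth X b)) q.+1.
Proof.
move=> tq inv; have [m w mi u _] := peer_inv_learn b inv.
by split=> //; apply: query_budget_query tq (inv_budget inv).
Qed.

Lemma peer_inv_mark i s x q : to_send s x ->
  peer_inv i s q -> peer_inv i (mark s x) q.
Proof.
case/and4P=> _ mx _ nx [m w mi u bu]; split=> // [j b|j]; rewrite /= /upd;
  case: ifP => _ //; last by rewrite rcons_uniq nx u.
  by rewrite mem_rcons inE => /predU1P[->|/mi//]; rewrite -m.
exact: mi.
Qed.

Lemma value_correct i s q b : peer_inv i s q -> known s b -> value s b = tnth X b.
Proof.
move=> inv; rewrite /known /value; case E: (view s b) => [v|] // _.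
exact: (inv_view inv E).
Qed.

(** The field [inv_heard] turns delivery into knowledge: at a peer with an empty inbox, every
    delivered bit is known. *)
Record inv (c : config download) : Prop := Inv {
  inv_peer : forall i, peer_inv i (loc c i) (queried c i);
  inv_issued : forall i j, issued c (i, j) = [seq msg b | b <- sent (loc c i) j];
  inv_inbox : forall i y, y \in inbox c i -> exists b, y.2 = msg b;
  inv_heard : forall i j r b, r \in delivered c (i, j) ->
    nth [bseq] (issued c (i, j)) r = msg b ->
    (i, msg b) \in inbox c j \/ known (loc c j) b
}.

Lemma inv_step c e : links_wf c -> inv c -> inv (step X c e).
Proof.
move=> wf; case: c wf => s F q iss tr dl ib; case: e => [i|l|l r|i] /= wf c_inv;
  last by case: c_inv.
- case: ifP => // _; rewrite /local_step /= /peer_act.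
  case: c_inv => /= ip ii io ih.
  case: pickP => [b tq|_].
    split=> //= [j|j j'|j j' r b'].
    + by rewrite /upd; case: eqP => [->|//]; exact: peer_inv_query.
    + by rewrite ii /upd; case: eqP => [->|].
    + move=> rd /(ih _ _ _ _ rd)[|kb]; [by left|right].
      by rewrite /upd; case: eqP => [<-|//]; rewrite known_learn kb orbT.
  case: pickP => [x ts|_].
    split=> //= [j|j j'|j j' r b'].
    + by rewrite /upd; case: eqP => [->|//]; exact: peer_inv_mark.
    + rewrite /mark /upd xpair_eqE; have [->|_] := eqVneq j i => /=; last exact: ii.
      case: ifP => _; last exact: ii.
      rewrite ii map_rcons /msg (value_correct (ip i)) //.
      by case/and4P: ts.
    (* A delivered packet was issued earlier, so appending a packet does not change the entry at
       [r]. *)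
    + move=> rd; have rlt : r < size (iss (j, j')).
        exact: leq_trans (wf_delivered wf rd) (wf_transmitted wf _).
      rewrite {1}/upd; case: eqP => [E|_]; rewrite ?nth_rcons -?E ?rlt;
        move=> /(ih _ _ _ _ rd)[|kb]; try by left.
        by right; rewrite /upd; case: eqP => [<-|//].
      by right; rewrite /upd; case: eqP => [<-|//].
  case: ifP => _ //; case Ei: (ib i) => [|[j0 p] ib'] //.
  have [b0 /= Ep] : exists b, p = msg b.
    by apply: (io i (j0, p)); rewrite Ei mem_head.
  rewrite Ep encK; split=> //= [j|j j'|j y|j j' r b'].
  + by rewrite /upd; case: eqP => [->|//]; exact: peer_inv_learn.
  + by rewrite ii /upd; case: eqP => [->|].
  + rewrite /upd; case: ifP => _; last exact: io.
    by move=> yib; apply: (io i); rewrite Ei inE yib orbT.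
  + move=> rd /(ih _ _ _ _ rd); rewrite /upd; case: eqP => [->|_] //.
    rewrite known_learn Ei inE Ep xpair_eqE.
    case=> [/orP[/andP[_ /eqP/(congr1 dec)]|]|->]; rewrite ?orbT; auto.
    (* The packet just read encodes [b'], so decoding identifies [b'] with the bit just learned. *)
    by rewrite !encK => -[->]; rewrite eqxx; right.
- by case: ifP => // _; case: c_inv.
- case: ifP => // /andP[rt rn]; case: c_inv => /= ip ii io ih.
  split=> //= [j y|i j r' b'].
  + rewrite /upd; case: ifP => _; last exact: io.
    rewrite mem_rcons inE => /predU1P[->|/io//] /=.
    have rlt : r < size (iss l) := leq_trans rt (wf_transmitted wf _).
    case: l {rn rt} rlt => l1 l2 /=; rewrite ii size_map => rlt.
    have [b0 _] : exists b0, b0 \in sent (s l1) l2.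
      by case: (sent (s l1) l2) rlt => // b0 ?; exists b0; rewrite mem_head.
    by exists (nth b0 (sent (s l1) l2) r); rewrite (nth_map b0).
  + rewrite {1}/upd; case: eqP => [<-|nl].
      rewrite inE => /predU1P[-> ->|].
        by left; rewrite /upd eqxx mem_rcons mem_head.
      move=> rd /(ih _ _ _ _ rd)[H|]; [left|by right].
      by rewrite /upd eqxx mem_rcons inE orbC H.
    move=> rd /(ih _ _ _ _ rd)[H|]; [left|by right].
    by rewrite /upd; case: eqP => [<-|//]; rewrite mem_rcons inE orbC H.
Qed.

Variable ev : nat -> event k.
Local Notation conf := (@conf n k B download X ev).

Lemma conf_inv t : inv (conf t).
Proof.
elim: t => [|t IH]; last exact/inv_step/IH/conf_wf.
split=> //= i; split=> //= [b v|]; first by rewrite ffunE.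
by exists i.
Qed.

Lemma peer_conf t i : peer_inv i (loc (conf t) i) (queried (conf t) i).
Proof. exact: inv_peer (conf_inv t) i. Qed.

Lemma known_step (c : config download) e i b :
  known (loc c i) b -> known (loc (step X c e) i) b.
Proof.
case: c => s F q iss tr dl ib; case: e => [i'|l|l r|i'] //= kb;
  do ?by case: ifP.
case: ifP => // _; rewrite /local_step /= /peer_act.
case: pickP => [b' _|_].
  by rewrite /= /upd; case: eqP => [<-|//]; rewrite known_learn kb orbT.
case: pickP => [x _|_]; first by rewrite /= /upd; case: eqP => [<-|].
case: ifP => //= _; case: (ib i') => [|[j p] ib'] //=.
rewrite /upd; case: eqP => [<-|//]; case: (dec p) => [[b' v]|] //.
by rewrite known_learn kb orbT.
Qed.

Lemma known_conf t t' i b : t <= t' ->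
  known (loc (conf t) i) b -> known (loc (conf t') i) b.
Proof.
elim: t' => [|t' IH]; first by rewrite leqn0 => /eqP->.
rewrite leq_eqVlt => /predU1P[-> //|]; rewrite ltnS => /IH{}IH /IH.
exact: known_step.
Qed.

Lemma blocked t i : i \notin crashed (conf t) -> ~~ active (conf t) i ->
  [/\ forall b, ~~ to_query (loc (conf t) i) b,
      forall x, ~~ to_send (loc (conf t) i) x &
      (forall b, known (loc (conf t) i) b) \/ inbox (conf t) i = [::]].
Proof.
move=> nF; rewrite /active nF /= /peer_act.
case: pickP => // nq; case: pickP => [x /and4P[_ _ + _]|ns].
  by rewrite (inv_me (peer_conf t i)) => ->.
move=> ni; split=> [b|x|]; rewrite ?nq ?ns //.
by move: ni; case: ifP => [/forallP|_ /negbNE/eqP]; [left|right].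
Qed.

(* For termination the three configurations are a single late one; for the time
   bound they are the first ones after the times 0, D and 2D, where D bounds the
   number of packets per link. *)
Section Stages.
Variables v u1 u2 : nat.
Hypotheses (vu1 : v <= u1) (u12 : u1 <= u2).
Hypotheses (qv : quiescent (conf v)) (q1 : quiescent (conf u1)).
Hypothesis q2 : quiescent (conf u2).
Hypotheses (av : arrived download X ev v u1) (a1 : arrived download X ev u1 u2).
Hypothesis few : #|crashed (conf u2)| <= 1.
Local Notation F := (crashed (conf u2)).

(** By quiescence [i] has sent [b] before [t]. At [u] the packet has arrived, and [j] has either
    read it or already knows everything. *)
Lemma relayed t u i j b : t <= u -> u <= u2 ->
  quiescent (conf t) -> quiescent (conf u) -> arrived download X ev t u ->
  i \notin F -> j \notin F -> mine i b ->
  known (loc (conf t) i) b -> known (loc (conf u) j) b.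
Proof.
move=> tu uu2 qt qu ar iF jF mb kb.
have [<-|ij] := eqVneq i j; first exact: known_conf tu kb.
have nFat w h : w <= u2 -> h \notin F -> h \notin crashed (conf w).
  by move=> wu2; apply: contra; exact: crashed_conf.
have [_ ns _] := blocked (nFat t i (leq_trans tu uu2) iF) (qt i).
have bs : b \in sent (loc (conf t) i) j.
  have := ns (b, j).
  by rewrite /to_send (inv_me (peer_conf t i)) /= kb mb eq_sym ij /= negbK.
have [_ _ []] := blocked (nFat u j uu2 jF) (qu j); first exact.
move=> ib0; set r := index b (sent (loc (conf t) i) j).
have rlt : r < size (issued (conf t) (i, j)).
  by rewrite (inv_issued (conf_inv t)) size_map index_mem.
have rd := ar (i, j) r rlt (nFat u i uu2 iF).
have [||] // := inv_heard (b := b) (conf_inv u) rd; last by rewrite ib0.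
rewrite (nth_issued_conf tu rlt) (inv_issued (conf_inv t)).
by rewrite (nth_map b) ?index_mem // nth_index.
Qed.

(** The owner has queried the bit by [v] and its packet arrives by [u1]. Crashes are taken at [u2],
    so a peer outside [F] is alive at all three stages. *)
Lemma primary_known i b : i \notin F -> own1 b \notin F ->
  known (loc (conf u1) i) b.
Proof.
move=> iF oF; have mb : mine (own1 b) b by rewrite /mine eqxx.
apply: (relayed vu1 u12 qv q1 av oF iF mb).
have oFv : own1 b \notin crashed (conf v).
  by apply: contra oF; apply: crashed_conf; exact: leq_trans u12.
have [/(_ b) nq _ _] := blocked oFv (qv _).
by move: nq; rewrite /to_query (inv_me (peer_conf v _)) eqxx andbT negbK.
Qed.

Lemma secondary_known b : own2 b \notin F ->
  known (loc (conf u1) (own2 b)) b.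
Proof.
move=> oF; have oF1 : own2 b \notin crashed (conf u1).
  by apply: contra oF; exact: crashed_conf.
have [/(_ b) + _ _] := blocked oF1 (q1 _).
rewrite /to_query (inv_me (peer_conf u1 _)) eqxx andTb.
suff -> : [exists j, all_but (loc (conf u1) (own2 b)) j].
  by rewrite orbT andbT negbK.
(* The exempted block is that of the crashed peer, or an arbitrary one if nobody has crashed. *)
have [j Fj] : exists j, forall j', j' != j -> j' \notin F.
  have [F0|[j jF]] := set_0Vmem F.
    by exists (own2 b) => j' _; rewrite F0 inE.
  exists j => j'; apply: contra => j'F; apply/eqP.
  exact: (card_le1_eqP few).
apply/existsP; exists j; apply/forallP => b'; apply/implyP => /Fj.
exact: primary_known.
Qed.

Lemma final_output i : i \notin F -> output (conf u2) i = Some X.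
Proof.
move=> iF; have all_known b : known (loc (conf u2) i) b.
  have [oF|oF] := boolP (own1 b \in F); last first.
    exact: known_conf u12 (primary_known iF oF).
  have o2F : own2 b \notin F.
    apply: contra (own_neq b) => o2F; apply/eqP; exact: (card_le1_eqP few).
  apply: (relayed u12 _ q1 q2 a1 o2F iF) => //; first by rewrite /mine eqxx orbT.
  exact: secondary_known.
have [nq ns _] := blocked iF (q2 i).
rewrite /output /= /peer_act; case: pickP => [b|_].
  by rewrite (negbTE (nq b)).
case: pickP => [x|_]; first by rewrite (negbTE (ns x)).
have -> : [forall b, known (loc (conf u2) i) b] by apply/forallP.
congr Some; apply: eq_from_tnth => b; rewrite tnth_mktuple.
exact: value_correct (peer_conf u2 i) (all_known b).
Qed.

End Stages.
End Correctness.

(** * Query, packet, termination and time bounds *)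

Section Complexity.
Variables m q : nat.
Hypothesis own1_card : forall i, #|[set b | own1 b == i]| <= m.
Hypothesis own2_card : forall i, #|[set b | own2 b == i]| <= m.
Hypothesis own12_card : forall i j,
  #|[set b | (own1 b == j) && (own2 b == i)]| <= q.
Variables (X : n.-tuple bool) (ev : nat -> event k).
Local Notation conf := (@conf n k B download X ev).

Lemma queried_le t i : queried (conf t) i <= m + q.
Proof.
have inv := peer_conf X ev t i; have [j le] := inv_budget inv.
apply: leq_trans le _; apply: leq_add.
  apply: leq_trans (own1_card i); apply/subset_leq_card/subsetP => b.
  by rewrite !inE (inv_me inv) => /andP[].
apply: leq_trans (own12_card i j); case: all_but => //; rewrite mul1n.
apply/subset_leq_card/subsetP => b.
by rewrite !inE (inv_me inv) => /and3P[_ -> ->].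
Qed.

Lemma issued_le t l : size (issued (conf t) l) <= m.*2.
Proof.
case: l => i j; rewrite (inv_issued (conf_inv X ev t)) size_map.
have inv := peer_conf X ev t i; rewrite -(card_uniqP (inv_uniq inv j)).
rewrite -addnn; apply: leq_trans (leq_add (own1_card i) (own2_card i)).
apply: leq_trans (leq_of_leqif (leq_card_setU _ _)).
by apply/subset_leq_card/subsetP => b /(inv_mine inv); rewrite !inE.
Qed.

Lemma download_settled : admissible download 1 X ev ->
  exists N, forall i t, i \notin crashed (conf N) -> N <= t ->
    output (conf t) i = Some X.
Proof.
move=> adm; have := eventually_settled adm (fun t =>
  progress_le (conf_wf download X ev t) (queried_le t) (issued_le t)).
move=> [N [qN aN const]]; exists N => i t iF /const->.
exact: (final_output (leqnn N) (leqnn N) qN qN qN aN aN (few_crashes adm N)).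
Qed.

Lemma download_time (R : realType) (tau : nat -> R) i :
  admissible download 1 X ev -> normalized_time download X ev tau ->
  nonfaulty download X ev i ->
  exists2 t, (tau t <= (4 * m)%:R)%R & output (conf t.+1) i.
Proof.
move=> adm nt nf; pose D : R := ((m.*2)%:R)%R.
have D0 : (0 <= D)%R by rewrite ler0n.
have TE : ((4 * m)%:R = D + D :> R)%R by rewrite /D -natrD; congr (_%:R)%R; lia.
(* If the clock never passes [2D], every event is early enough and termination suffices. *)
have [[u Tu]|early] := classic (exists u, (D + D < tau u)%R).
  have [u2 [q2 _ Tu2 before2]] := first_after nt (addr_ge0 D0 D0) Tu.
  have Du2 : (D < tau u2)%R by lra.
  have [u1 [q1 u12 Du1 before1]] := first_after nt D0 Du2.
  have u1_0 : (0 < tau u1)%R by lra.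
  have [v [qv vu1 _ before0]] := first_after nt (lexx 0%R) u1_0.
  have av : arrived download X ev v u1.
    by apply: (arrived_after nt (issued_le v) before0); rewrite add0r.
  have a1 : arrived download X ev u1 u2 :=
    arrived_after nt (issued_le u1) before1 Tu2.
  have out := final_output vu1 u12 qv q1 q2 av a1 (few_crashes adm u2) (nf u2).
  (* The event just before the clock passes [2D] is the one charged; it exists because the clock
     starts at 0. *)
  case: u2 out Tu2 before2 {q2 u12 Du2 a1} => [|u2] out Tu2 before2.
    by move: Tu2; rewrite (time_start nt) => ?; lra.
  by exists u2; [rewrite TE; exact: before2|rewrite out].
have [N /(_ i N.+1 (nf N))/(_ (leqnSn N)) out] := download_settled adm.
exists N; last by rewrite out.
by rewrite TE leNgt; apply/negP => ?; apply: early; exists N.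
Qed.

End Complexity.
End Download.

(** * Owners and packets *)

Lemma ltn_div_ceil a n d : 0 < d -> a < n -> a %/ d < ceil_div n d.
Proof.
move=> d0 an; rewrite /ceil_div ltn_divLR // mulnC.
have := divn_eq (n + d.-1) d; have := ltn_pmod (n + d.-1) d0; lia.
Qed.

Lemma card_le_label n M (A : {set 'I_n}) (f : nat -> nat) :
  (forall b, b \in A -> f b < M) ->
  {in A &, forall b b' : 'I_n, f b = f b' -> b = b'} -> #|A| <= M.
Proof.
(* [inord] needs a nonempty ordinal type, so the bound 0 is treated apart. *)
case: M => [|M] fM finj.
  by rewrite leqn0 cards_eq0; apply/set0Pn => -[b /fM].
rewrite -[leqRHS]card_ord.
apply: (leq_card_in (fun b : 'I_n => inord (f b) : 'I_M.+1)).
move=> b b' bA b'A /(congr1 val); rewrite /= !inordK ?fM //; exact: finj.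
Qed.

Section Owners.
Variables (n k : nat).
Hypothesis k2 : 1 < k.

Lemma k_gt0 : 0 < k. Proof. exact: ltnW. Qed.

Definition owner1 (b : 'I_n) : 'I_k := Ordinal (ltn_pmod b k_gt0).

(* The secondary owner rotates with the rank [b %/ k] of the bit in its block, so
   that each peer is the secondary owner of at most one bit of every rank. *)
Definition owner2 (b : 'I_n) : 'I_k :=
  Ordinal (ltn_pmod (b %% k + ((b %/ k) %% k.-1).+1) k_gt0).

Lemma shift_inj a x y : x < k -> y < k ->
  (a + x) %% k = (a + y) %% k -> x = y.
Proof.
by move=> xk yk /eqP; rewrite eqn_modDl !modn_small // => /eqP.
Qed.

(** The rotation lies between 1 and [k - 1]: nonzero, it separates the owners, and below [k], it is
    determined by its residue. *)
Lemma rank_lt (b : nat) : ((b %/ k) %% k.-1).+1 < k.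
Proof. by have : (b %/ k) %% k.-1 < k.-1 by [rewrite ltn_pmod; lia]; lia. Qed.

Lemma owner_neq b : owner1 b != owner2 b.
Proof.
apply/negP => /eqP/(congr1 val) /= E.
have : (b %% k + 0) %% k = (b %% k + ((b %/ k) %% k.-1).+1) %% k.
  by rewrite addn0 modn_mod.
by move/(shift_inj k_gt0 (rank_lt b)).
Qed.

Lemma owner1_card i : #|[set b | owner1 b == i]| <= ceil_div n k.
Proof.
apply: (card_le_label (f := fun b => b %/ k)) => [b _|b b'].
  exact: ltn_div_ceil k_gt0 (ltn_ord b).
rewrite !inE => /eqP/(congr1 val) /= E /eqP/(congr1 val) /= E' Eq.
by apply/val_inj; rewrite /= (divn_eq b k) (divn_eq b' k) E E' Eq.
Qed.

Lemma owner2_card i : #|[set b | owner2 b == i]| <= ceil_div n k.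
Proof.
apply: (card_le_label (f := fun b => b %/ k)) => [b _|b b'].
  exact: ltn_div_ceil k_gt0 (ltn_ord b).
rewrite !inE => /eqP/(congr1 val) /= E /eqP/(congr1 val) /= E' Eq.
apply/val_inj; rewrite /= (divn_eq b k) (divn_eq b' k) Eq; congr addn.
move: E; rewrite -E' Eq ![_ %% k + _]addnC.
by apply: shift_inj; exact: ltn_pmod k_gt0.
Qed.

(** The two owners determine [b %% k] and the rank modulo [k.-1], so only the quotient by [k * k.-1]
    is left to tell bits apart. *)
Lemma owner12_card i j :
  #|[set b | (owner1 b == j) && (owner2 b == i)]| <= ceil_div n (k * k.-1).
Proof.
apply: (card_le_label (f := fun b => b %/ (k * k.-1))) => [b _|b b'].
  apply: ltn_div_ceil (ltn_ord b); lia.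
rewrite !inE => /andP[/eqP/(congr1 val) /= E1 /eqP/(congr1 val) /= E2].
move=> /andP[/eqP/(congr1 val) /= E1' /eqP/(congr1 val) /= E2'].
rewrite !divnMA => Eq.
have {E2 E2'} Er : (b %/ k) %% k.-1 = (b' %/ k) %% k.-1.
  apply: succn_inj; apply: (shift_inj (a := j)); try exact: rank_lt.
  by rewrite -[in LHS]E1 -[in RHS]E1' E2 E2'.
apply/val_inj; rewrite /= (divn_eq b k) (divn_eq b' k) E1 E1'.
by rewrite (divn_eq (b %/ k) k.-1) (divn_eq (b' %/ k) k.-1) Eq Er.
Qed.

End Owners.

(** * Encoding a finite type in packets *)

Section Encoding.
Variables (T : finType) (B : nat).
Hypothesis TB : #|T| <= 2 ^ B.

Lemma card_tuple_ge : #|T| <= #|{: B.-tuple bool}|.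
Proof. by rewrite card_tuple card_bool. Qed.

Definition encode (x : T) : packet B :=
  bseq_of_tuple (enum_val (widen_ord card_tuple_ge (enum_rank x))).

Definition decode (p : packet B) : option T := [pick x | encode x == p].

Lemma encodeK : pcancel encode decode.
Proof.
move=> x; rewrite /decode; case: pickP => [y /eqP/(congr1 val) /= E|/(_ x)].
  congr Some; apply/enum_rank_inj/val_inj.
  by have /enum_val_inj/(congr1 val) := val_inj E.
by rewrite eqxx.
Qed.

End Encoding.

Theorem theorem6p4 (R : realType) :
  exists C c : nat, forall n k : nat, 2 <= k -> k <= n ->
  exists P : protocol n k (C * up_log 2 n),
    [/\ solves_download P 1,
        query_complexity_le P 1 (ceil_div n k + ceil_div n (k * k.-1)),
        time_complexity_le P 1
          ((C * up_log 2 (n * k) ^ c)%:R * (n%:R / k%:R) : R)%R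
      & message_complexity_le P 1 (C * (n * k))].
Proof.
(* The constant 10 is generous: with [ceil_div n k] at most [2n/k], the time is at most [8n/k], with
   no logarithmic factor, and the messages number at most [4nk]. *)
exists 10, 0 => n k k2 kn.
have n1 : 1 < n := leq_trans k2 kn.
have TB : #|{: 'I_n * bool}| <= 2 ^ (10 * up_log 2 n).
  rewrite card_prod card_ord card_bool.
  have L0 : 0 < up_log 2 n by rewrite up_log_gt0 n1.
  apply: (@leq_trans (2 ^ (up_log 2 n).+1)); last by rewrite leq_exp2l //; lia.
  by rewrite expnSr leq_mul2r up_logP.
(* Rounding up costs at most a factor 2 because [k <= n]. *)
have mk : ceil_div n k * k <= 2 * n.
  by apply: leq_trans (leq_trunc_div _ _) _; lia.
have c1 := @owner1_card n k k2; have c2 := @owner2_card n k k2.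
have c12 := @owner12_card n k k2.
have encK := encodeK TB; have neq := @owner_neq n k k2.
exists (download (@owner1 n k k2) (@owner2 n k k2) (encode TB) (decode TB)).
split.
- move=> X ev adm i nf; have [N out] := download_settled encK neq c1 c2 c12 adm.
  by exists N; exact: out (nf N) (leqnn N).
- by move=> X ev _ i _ t; exact (queried_le encK c1 c12 X ev t i).
- move=> X ev tau adm nt i nf.
  have [t tT out] := download_time encK neq c1 c2 c12 adm nt nf; exists t => //.
  apply: le_trans tT _; rewrite expn0 muln1 mulrA.
  rewrite ler_pdivlMr ?ltr0n ?(ltnW k2) //; rewrite -!natrM ler_nat; lia.
- move=> X ev _ H _ t.
  apply: (@leq_trans (\sum_(i < k) \sum_(j < k) (ceil_div n k).*2)).
    rewrite [leqRHS](bigID (mem H)) /=; apply: leq_trans (leq_addr _ _).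
    by do 2!apply: leq_sum => ? _; exact (issued_le encK c1 c2 X ev t _).
  by rewrite !sum_nat_const !card_ord; nia.
Qed.
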